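(* Let $\mathcal N=\{1,\dots,N\}$ be a set of agents. For each $i\in\mathcal N$ let $Q_i(\tau_i,a_i;\theta_i)$ be agent $i$'s action-value function with parameter vector $\theta_i$, where for $i\ne j$ the parameters $\theta_i,\theta_j$ are distinct (i.e. parameters are not shared between agents), and put $\bm\theta=(\theta_1,\dots,\theta_N)$. Let $\mathcal F(\,\cdot\,,s;\phi)$ be a mixing function with parameter vector $\phi$, and write $\mathcal Q^N=\{Q_1(\tau_1,a_1;\theta_1),\dots,Q_N(\tau_N,a_N;\theta_N)\}$. Let $Q_T(\bm\tau',\bm a')$ be a target function, let $\gamma\in[0,1)$, and let samples $(\bm\tau,\bm a,r^{ext},\bm\tau')$ (together with the state $s$) be drawn from a replay buffer $\mathcal D$. Define the global target $$\mathcal L^G(\bm\theta,\phi)=\mathbb E_{\mathcal D}\Big[\big(r^{ext}+\gamma\max_{\bm a'}Q_T(\bm\tau',\bm a')-\mathcal F(\mathcal Q^N,s;\phi)\big)^2\Big]$$ and, for each $i\in\mathcal N$, the individual target $$\mathcal L_i^E(\theta_i,\phi)=\mathbb E_{\mathcal D}\big[\mathcal P\cdot\mathcal F(\mathcal Q^N,s;\phi)\big],\qquad \mathcal P=-2\Big(r^{ext}+\gamma\max_{\bm a'}Q_T(\bm\tau',\bm a')-\mathcal F(\mathcal Q^N,s;\phi)\Big),$$ where $\mathcal P$ is treated as a scalar not involved in the gradient calculation: when $\mathcal L_i^E$ is differentiated, $\mathcal P$ is held constant at its value at the current parameters $(\bm\theta,\phi)$. Then for every $i\in\mathcal N$, $$\frac{\partial\mathcal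 L^G(\bm\theta,\phi)}{\partial\theta_i}=\frac{\partial\mathcal L_i^E(\theta_i,\phi)}{\partial\theta_i},$$ and $$\frac{\partial\mathcal L^G(\bm\theta,\phi)}{\partial\phi}=\frac1N\sum_{i=1}^N\frac{\partial\mathcal L_i^E(\theta_i,\phi)}{\partial\phi}.$$
   Context: Setting: centralized training with decentralized execution (CTDE) for a cooperative multi-agent task with $N$ agents. Agent $i$ has observation-action history $\tau_i$ and picks an action $a_i$ from a finite set $\mathcal A_i$; $\bm\tau=(\tau_1,\dots,\tau_N)$, $\bm a=(a_1,\dots,a_N)$, and $\bm a'$ ranges over joint actions in $\mathcal A_1\times\dots\times\mathcal A_N$. $s$ is the global state, $r^{ext}\in\mathbb R$ is the shared team reward, and $\bm\tau'$ is the next joint history. The replay buffer $\mathcal D$ is a finite collection of recorded transitions; $\mathbb E_{\mathcal D}$ is the expectation over a transition sampled from it. The mixing function $\mathcal F$ maps the $N$ real numbers $Q_i(\tau_i,a_i;\theta_i)$ and the state $s$ to a real number, the joint action value $Q_{tot}(\bm\tau,\bm a;\bm\theta,\phi)=\mathcal F(\mathcal Q^N,s;\phi)$. The real-valued functions $Q_i$ are differentiable in $\theta_i$, and $\mathcal F$ is differentiable in its $N$ real inputs and in $\phi$ jointly. The target function $Q_T$ (a target network) is held fixed, i.e. does not depend on $(\bm\theta,\phi)$ for the purposes of differentiation. Holding $\mathcal P$ constant means: for fixed $(\bar{\bm\theta},\bar\phi)$, the partial derivative of $\mathcal L_i^E$ at $(\bar{\bm\theta},\bar\phi)$ is that of $(\bm\theta,\phi)\mapsto\mathbb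 E_{\mathcal D}[\bar{\mathcal P}\cdot\mathcal F(\mathcal Q^N,s;\phi)]$ at that point, where $\bar{\mathcal P}$ is the (sample-dependent) value of $\mathcal P$ evaluated at $(\bar{\bm\theta},\bar\phi)$. *)

(* Defs.v *)
From HB Require Import structures.
From mathcomp Require Import all_boot all_order all_algebra.
From mathcomp Require Import all_classical all_reals all_analysis.

Set Implicit Arguments.
Unset Strict Implicit.
Unset Printing Implicit Defensive.

Import Order.TTheory GRing.Theory Num.Theory.
Import numFieldNormedType.Exports.

Local Open Scope ring_scope.

(* Agents are the elements of ['I_N].  Agent [i] has histories in
   the type [H i], actions in the finite type [A i] and parameters in
   ['rV[R]_(d i)].  Each agent owns its own coordinate of the dependent family
   [theta : forall i, 'rV[R]_(d i)], so parameters are not shared. *)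

(* The vector of partial derivatives of [f] at [x]. *)
Definition grad (R : realType) (n : nat) (f : 'rV[R]_n -> R) (x : 'rV[R]_n) :
  'rV[R]_n := \row_j 'D_('e_j) f x.

Section Model.
Variables (R : realType) (N : nat).
Variables (H : 'I_N -> Type) (A : 'I_N -> finType) (St : Type).

Definition joint_history := forall i : 'I_N, H i.
Definition joint_action := {dffun forall i : 'I_N, A i}.

Record transition := Transition {
  tr_history : joint_history;
  tr_action : joint_action;
  tr_reward : R;
  tr_next : joint_history;
  tr_state : St }.

(* A finite collection of (possibly repeated) transitions, with an arbitrary
   sampling distribution on it; uniform sampling is [buf_prob k = buf_size^-1]. *)
Record replay_buffer := ReplayBuffer {
  buf_size : nat;
  buf_item : 'I_buf_size -> transition;
  buf_prob : 'I_buf_size -> R;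
  buf_prob_ge0 : forall k, 0 <= buf_prob k;
  buf_prob_sum1 : \sum_k buf_prob k = 1 }.

Definition expect (D : replay_buffer) (f : transition -> R) : R :=
  \sum_(k < buf_size D) buf_prob k * f (buf_item k).

(* [a0] only supplies a member of the range of [f] as the initial value of the
   iterated maximum, so the result is the maximum whatever [a0] is. *)
Definition max_action (a0 : joint_action) (f : joint_action -> R) : R :=
  \big[Num.max/f a0]_(a : joint_action) f a.

Variables (d : 'I_N -> nat) (m : nat).
Variable Q : forall i : 'I_N, H i -> A i -> 'rV[R]_(d i) -> R.
Variable F : 'rV[R]_N -> St -> 'rV[R]_m -> R.
Variable QT : joint_history -> joint_action -> R.
Variable gamma : R.

Definition params := forall i : 'I_N, 'rV[R]_(d i).

Definition Qvec (theta : params) (x : transition) : 'rV[R]_N :=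
  \row_(i < N) @Q i (tr_history x i) (tr_action x i) (theta i).

Definition Qtot (theta : params) (phi : 'rV[R]_m) (x : transition) : R :=
  F (Qvec theta x) (tr_state x) phi.

Definition td_target (x : transition) : R :=
  tr_reward x + gamma * max_action (tr_action x) (QT (tr_next x)).

Definition LG (D : replay_buffer) (theta : params) (phi : 'rV[R]_m) : R :=
  expect D (fun x => (td_target x - Qtot theta phi x) ^+ 2).

Definition Pcoef (theta : params) (phi : 'rV[R]_m) (x : transition) : R :=
  - 2 * (td_target x - Qtot theta phi x).

(* The individual target of agent [i] as a function of the variables
   [(t, phi)], [t] being agent [i]'s parameters.  The current parameters
   [(theta0, phi0)] are held fixed: they provide the value of [Pcoef] and the
   parameters of the agents other than [i]. *)
Definition LE (D : replay_buffer) (theta0 : params) (phi0 : 'rV[R]_m)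
    (i : 'I_N) (t : 'rV[R]_(d i)) (phi : 'rV[R]_m) : R :=
  expect D (fun x => Pcoef theta0 phi0 x * Qtot (dfwith theta0 i t) phi x).

End Model.

Arguments LE {R N H A St d m} Q F QT gamma D theta0 phi0 i t phi.

(* Main.v *)
(* By the chain rule the derivative of (c - f)^2 at v is -2 (c - f v) times that
   of f, which is also the derivative at v of f scaled by the frozen constant
   -2 (c - f v).  Expectations over the buffer are finite sums, so they commute
   with derivatives.  For phi the individual targets do not depend on the agent
   once theta is fixed, hence the average of N equal gradients. *)

Require Import Defs.
From mathcomp Require Import all_boot all_order all_algebra.
From mathcomp Require Import all_classical all_reals all_analysis.
From mathcomp Require Import ring.

Set Implicit Arguments.
Unset Strict Implicit.
Unset Printing Implicit Defensive.

Import Order.TTheory GRing.Theory Num.Theory.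
Import numFieldNormedType.Exports.

Local Open Scope ring_scope.

Lemma is_diff_sum (R : numFieldType) (V W : normedModType R) (n : nat)
    (f df : 'I_n -> V -> W) (v : V) :
  (forall i, is_diff v (f i) (df i)) ->
  is_diff v (\sum_i f i) (\sum_i df i).
Proof.
move=> fdf; elim/big_rec2: _ => [|i g dg _ gdg]; first exact: is_diff_cst.
exact: is_diffD.
Qed.

Lemma is_diff_expect (R : realType) (N : nat) (H : 'I_N -> Type)
    (A : 'I_N -> finType) (St : Type) (D : replay_buffer R H A St)
    (V : normedModType R) (f df : transition R H A St -> V -> R) (v : V) :
  (forall x, is_diff v (f x) (df x)) ->
  is_diff v (fun t => expect D (f^~ t)) (fun h => expect D (df^~ h)).
Proof.
move=> fdf.
(* The expectation becomes a linear combination of functions, the form on which [is_diff_sum] and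
   [is_diffZ] act. *)
have expectE g : (fun t : V => expect D (g^~ t)) =
    \sum_(k < buf_size D) buf_prob k *: g (buf_item k).
  by apply/funext => t; rewrite fct_sumE.
by rewrite !expectE; apply: is_diff_sum => k; apply: is_diffZ.
Qed.

Lemma is_diff_sqr_residual (R : realType) (V : normedModType R) (c : R)
    (f df : V -> R) (v : V) :
  is_diff v f df ->
  is_diff v (fun t => (c - f t) ^+ 2) (fun h => - 2 * (c - f v) * df h).
Proof.
move=> fdf.
have -> : (fun t => (c - f t) ^+ 2) = (cst c - f) * (cst c - f).
  by apply/funext => t; rewrite expr2.
apply: is_diff_eq; apply/funext => h.
(* The constant [c] contributes the zero function; its value at [h] is reduced to the scalar 0 for
   [ring]. *)
rewrite /= !fctE /GRing.scale/= -[(0 : V -> R) h]/0; ring.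
Qed.

(** Both functions have the same differential at [v]. The family [f] is left abstract so that the
    result serves for each agent's parameters and for [phi] alike. *)
Lemma expect_sqr_semigradient (R : realType) (N : nat) (H : 'I_N -> Type)
    (A : 'I_N -> finType) (St : Type) (D : replay_buffer R H A St) (n : nat)
    (c : transition R H A St -> R) (f : transition R H A St -> 'rV[R]_n -> R)
    (v : 'rV[R]_n) :
  (forall x, differentiable (f x) v) ->
  let G := fun t => expect D (fun x => (c x - f x t) ^+ 2) in
  let E := fun t => expect D (fun x => - 2 * (c x - f x v) * f x t) in
  [/\ differentiable G v, differentiable E v & grad G v = grad E v].
Proof.
move=> fd G E.
pose g h := expect D (fun x => - 2 * (c x - f x v) * 'd (f x) v h).
have Gg : is_diff v G g.
  by apply: is_diff_expect => x; apply/is_diff_sqr_residual/differentiableP.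
have Eg : is_diff v E g.
  by apply: is_diff_expect => x; apply/is_diffZ/differentiableP.
have [dG dE] : differentiable G v /\ differentiable E v by split.
(* At a point of differentiability, each partial derivative is the differential evaluated at
   ['e_j]. *)
split=> //; apply/rowP => j; rewrite !mxE !deriveE //.
by rewrite (diff_val (is_diff_def := Gg)) (diff_val (is_diff_def := Eg)).
Qed.

(** A row is the sum of its entries times the basis vectors. *)
Lemma differentiable_row (R : numFieldType) (V : normedModType R) (n : nat)
    (f : 'I_n -> V -> R) (v : V) :
  (forall i, differentiable (f i) v) ->
  differentiable (fun t => \row_i f i t) v.
Proof.
move=> fd.
have -> : (fun t => \row_i f i t) =
    \sum_i (fun t => f i t *: ('e_i : 'rV[R]_n)).
  apply/funext => t; rewrite fct_sumE [LHS]row_sum_delta.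
  by apply: eq_bigr => i _; rewrite mxE.
by apply: differentiable_sum => i; apply: differentiableZl.
Qed.

Lemma dfwith_self (I : eqType) (T : I -> Type) (f : forall i, T i) (i : I) :
  dfwith f i (f i) = f.
Proof. by apply: functional_extensionality_dep => j; case: dfwithP. Qed.

(** Since parameters are not shared, only entry [i] of the mixer's input moves with [t]; the other
    entries and [phi] are constant. *)
Lemma differentiable_Qtot_theta (R : realType) (N : nat)
    (H : 'I_N -> Type) (A : 'I_N -> finType) (St : Type)
    (d : 'I_N -> nat) (m : nat)
    (Q : forall i : 'I_N, H i -> A i -> 'rV[R]_(d i) -> R)
    (F : 'rV[R]_N -> St -> 'rV[R]_m -> R)
    (Q_diff : forall (i : 'I_N) (h : H i) (a : A i) (t : 'rV[R]_(d i)),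
      differentiable (Q i h a) t)
    (F_diff : forall (s : St) (z : 'rV[R]_N * 'rV[R]_m),
      differentiable (fun y : 'rV[R]_N * 'rV[R]_m => F y.1 s y.2) z)
    (theta : params R d) (phi : 'rV[R]_m)
    (x : transition R H A St) (i : 'I_N) (t : 'rV[R]_(d i)) :
  differentiable (fun t => Qtot Q F (dfwith theta i t) phi x) t.
Proof.
apply: (@differentiable_comp _ _ _ _
  (fun t => (Qvec Q (dfwith theta i t) x, phi))
  (fun y => F y.1 (tr_state x) y.2)) => //.
apply: differentiable_pair => //; apply: differentiable_row => j.
have [<-|ij] := eqVneq i j.
  by under eq_fun do rewrite dfwithin; apply: Q_diff.
by under eq_fun do rewrite dfwithout//; apply: differentiable_cst.
Qed.

(** Joint differentiability of [F] is restricted to the slice where the agents' values are fixed. *)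
Lemma differentiable_Qtot_phi (R : realType) (N : nat)
    (H : 'I_N -> Type) (A : 'I_N -> finType) (St : Type)
    (d : 'I_N -> nat) (m : nat)
    (Q : forall i : 'I_N, H i -> A i -> 'rV[R]_(d i) -> R)
    (F : 'rV[R]_N -> St -> 'rV[R]_m -> R)
    (F_diff : forall (s : St) (z : 'rV[R]_N * 'rV[R]_m),
      differentiable (fun y : 'rV[R]_N * 'rV[R]_m => F y.1 s y.2) z)
    (theta : params R d) (phi : 'rV[R]_m)
    (x : transition R H A St) :
  differentiable (Qtot Q F theta ^~ x) phi.
Proof.
apply: (@differentiable_comp _ _ _ _ (pair (Qvec Q theta x))
  (fun y => F y.1 (tr_state x) y.2)) => //.
exact: (differentiable_pair (differentiable_cst _ _)).
Qed.

Theorem theorem1 (R : realType) (N : nat) (N_gt0 : (0 < N)%N)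
    (H : 'I_N -> Type) (A : 'I_N -> finType) (St : Type)
    (d : 'I_N -> nat) (m : nat)
    (Q : forall i : 'I_N, H i -> A i -> 'rV[R]_(d i) -> R)
    (F : 'rV[R]_N -> St -> 'rV[R]_m -> R)
    (QT : joint_history H -> joint_action A -> R)
    (gamma : R) (gamma_ge0 : 0 <= gamma) (gamma_lt1 : gamma < 1)
    (D : replay_buffer R H A St)
    (Q_diff : forall (i : 'I_N) (h : H i) (a : A i) (t : 'rV[R]_(d i)),
      differentiable (Q i h a) t)
    (F_diff : forall (s : St) (z : 'rV[R]_N * 'rV[R]_m),
      differentiable (fun y : 'rV[R]_N * 'rV[R]_m => F y.1 s y.2) z)
    (theta : params R d) (phi : 'rV[R]_m) :
  (forall i : 'I_N,
    [/\ differentiable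
          (fun t => LG Q F QT gamma D (dfwith theta i t) phi) (theta i),
        differentiable
          (fun t => LE Q F QT gamma D theta phi i t phi) (theta i)
      & grad (fun t => LG Q F QT gamma D (dfwith theta i t) phi) (theta i)
        = grad (fun t => LE Q F QT gamma D theta phi i t phi) (theta i)]) /\
  [/\ differentiable (fun p => LG Q F QT gamma D theta p) phi,
      forall i : 'I_N,
        differentiable (fun p => LE Q F QT gamma D theta phi i (theta i) p) phi
    & grad (fun p => LG Q F QT gamma D theta p) phi
      = N%:R^-1 *: \sum_(i < N)
          grad (fun p => LE Q F QT gamma D theta phi i (theta i) p) phi].
Proof.
split=> [i|].
  have := expect_sqr_semigradient D (td_target QT gamma)
    (fun x => differentiable_Qtot_theta Q_diff F_diff theta phi x (theta i)).
  (* The coefficient comes out frozen at [dfwith theta i (theta i)], which is [theta], as in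
     [Pcoef]. *)
  by rewrite /= dfwith_self.
have [dG dE GE] := expect_sqr_semigradient D (td_target QT gamma)
  (differentiable_Qtot_phi Q F_diff theta phi).
(* With agent [i] at its current parameters, the right-hand side no longer mentions [i]. *)
have LE_phi i : (fun p => LE Q F QT gamma D theta phi i (theta i) p) =
    fun p => expect D (fun x => Pcoef Q F QT gamma theta phi x
                                * Qtot Q F theta p x).
  by apply/funext => p; rewrite /LE dfwith_self.
split=> [//|i|]; first by rewrite LE_phi.
under eq_bigr => i _ do rewrite LE_phi -GE.
(* The [N] equal gradients add up to [N] times one of them; [N_gt0] makes [N%:R] invertible. *)
rewrite sumr_const card_ord -[X in _ *: X]scaler_nat scalerA mulVf ?scale1r//.
by rewrite pnatr_eq0 -lt0n.
Qed.
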